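(* Let $\mathcal{M}=\mathcal{M}(G;\mathfrak{I}^{\mathrm{And\text{-}Is}})$ be the And Ising hypergraphical model on a hypergraph $G=(V,E)$ with $|V|=n$. Its rank function equals the rank function of the boolean polymatroid of $G$: $$r_{\mathcal{M}}(A)=|\overline{A}|=\Bigl|\bigcup_{e\in A}e\Bigr|=\rho_G(A)\qquad\text{for all }A\subseteq E.$$
   Context: A hypergraph $G=(V,E)$ has a finite vertex set $V$ and a finite multiset $E$ of hyperedges, each a finite multiset of elements of $V$. For $A\subseteq E$, $\overline{A}\subseteq V$ denotes the set of vertices contained in some hyperedge of $A$; unions of hyperedges are taken as sets of vertices. The boolean polymatroid of $G$ has rank function $\rho_G(A)=|\overline{A}|$. And Ising family $\mathfrak{I}^{\mathrm{And\text{-}Is}}$: spin value set $S=\{0,1\}$ and $\Phi^k(s_1,\dots,s_k)=\prod_{i=1}^k s_i$. The induced model $\mathcal{M}(G;\mathfrak{I}^{\mathrm{And\text{-}Is}})$ has interaction functions $\phi^e(\boldsymbol{s})=\prod_{i\in e}s_i$ (with multiplicity) for $\boldsymbol{s}\in S^V$, $e\in E$. Its rank function is $r_{\mathcal{M}}(A)=|V|-\log_2\#\{\boldsymbol{s}\in S^V\mid\phi^e(\boldsymbol{s})=1\ \forall e\in A\}$ if this count is positive and $\infty$ otherwise, for $A\subseteq E$. *)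

(* Defs.v *)
From mathcomp Require Import all_boot all_order all_algebra.
From mathcomp Require Import finmap multiset.
From mathcomp Require Import reals constructive_ereal exp.

Set Implicit Arguments.
Unset Strict Implicit.
Unset Printing Implicit Defensive.

Import Order.TTheory GRing.Theory Num.Theory.

Local Open Scope mset_scope.
Local Open Scope ring_scope.

(* The multiset E is given as a family indexed by the finite type [edge]:
   repeated hyperedges have distinct indices, and a subset of E is a set of
   indices. *)
Record hypergraph := Hypergraph {
  vertex : finType;
  edge : finType;
  hyperedge : edge -> {mset vertex}
}.

Definition edge_support (G : hypergraph) (e : edge G) : {set vertex G} :=
  [set v | v \in hyperedge e].

Definition edge_cover (G : hypergraph) (A : {set edge G}) : {set vertex G} :=
  [set v | [exists e in A, v \in hyperedge e]].

Definition boolean_polymatroid_rank (G : hypergraph) (A : {set edge G}) : nat :=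
  #|edge_cover A|.

(* [Phi_sym] makes the value of Phi^k on the spins of a hyperedge independent of
   the order in which its elements are listed. *)
Record ising_family (R : realType) := IsingFamily {
  spin_values : finType;
  Phi : forall k : nat, k.-tuple spin_values -> R;
  Phi_sym : forall (k : nat) (s t : k.-tuple spin_values),
    perm_eq s t -> Phi s = Phi t
}.

Record model (R : realType) (G : hypergraph) := Model {
  spin : finType;
  interaction : edge G -> {ffun vertex G -> spin} -> R
}.

Definition induced_model (R : realType) (G : hypergraph)
    (I : ising_family R) : model R G :=
  @Model R G (spin_values I)
    (fun e s => Phi (map_tuple s (in_tuple (enum_mset (hyperedge e))))).

Definition satisfying (R : realType) (G : hypergraph) (M : model R G)
    (A : {set edge G}) : {set {ffun vertex G -> spin M}} :=
  [set s | [forall e in A, interaction e s == 1]].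

Definition log2 (R : realType) (x : R) : R := ln x / ln 2.

(* The base 2 of the logarithm is the normalization for two-valued spins. *)
Definition model_rank (R : realType) (G : hypergraph) (M : model R G)
    (A : {set edge G}) : \bar R :=
  if (0 < #|satisfying M A|)%N
  then (#|vertex G|%:R - log2 (#|satisfying M A|%:R))%:E
  else +oo%E.

Definition and_Phi (R : realType) (k : nat) (s : k.-tuple 'I_2) : R :=
  \prod_(x <- s) (x : nat)%:R.

Lemma and_Phi_sym (R : realType) (k : nat) (s t : k.-tuple 'I_2) :
  perm_eq s t -> and_Phi R s = and_Phi R t.
Proof. exact: perm_big. Qed.

Definition and_ising (R : realType) : ising_family R :=
  IsingFamily (@and_Phi_sym R).

(* Main.v *)
Require Import Defs.
From mathcomp Require Import all_boot all_order all_algebra.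
From mathcomp Require Import finmap multiset.
From mathcomp Require Import reals constructive_ereal exp.

(** Spins take the values 0 and 1, so a product of spins equals 1 exactly when
    every factor is 1. A configuration therefore satisfies all the
    interactions in A exactly when it is 1 on every vertex covered by A, and
    it is unconstrained elsewhere ([satisfying_andE]). There are
    2 ^ (n - |cover|) such configurations ([card_satisfying_and]); taking the
    base-2 logarithm of this positive count and subtracting it from n leaves
    the size of the cover. *)

Import Order.TTheory GRing.Theory Num.Theory.

Local Open Scope ring_scope.

Lemma edge_cover_bigcup (G : hypergraph) (A : {set edge G}) :
  edge_cover A = \bigcup_(e in A) edge_support e.
Proof.
apply/setP=> v; rewrite inE.
apply/exists_inP/bigcupP => -[e eA ve]; exists e => //; by rewrite inE in ve *.
Qed.

(** The spins are natural numbers in disguise: in [nat] a product is 1 only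
    when all its factors are, and the embedding of [nat] in [R] is
    injective. *)
Lemma and_Phi_eq1 (R : realType) (k : nat) (s : k.-tuple 'I_2) :
  (and_Phi R s == 1) = all (pred1 (inord 1)) s.
Proof.
rewrite /and_Phi -natr_prod pnatr_eq1; elim: (tval s) => [|x xs IH] /=.
  by rewrite big_nil.
by rewrite big_cons muln_eq1 IH -val_eqE /= inordK.
Qed.

(** The constraint set is a product over the vertices, of a singleton on each
    covered vertex and of all spin values on each other one; this form makes
    counting immediate. *)
Lemma satisfying_andE (R : realType) (G : hypergraph) (A : {set edge G}) :
  satisfying (induced_model G (and_ising R)) A =i
  family (fun v => if v \in edge_cover A then pred1 (inord 1 : 'I_2)
                   else predT).
Proof.
move=> s; rewrite inE; apply/forall_inP/familyP => [sat v | fam e eA].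
  case: ifP => //; rewrite inE => /exists_inP[e eA ve].
  have := sat e eA; rewrite /= and_Phi_eq1 /= all_map => /allP; exact.
rewrite /= and_Phi_eq1 /= all_map; apply/allP => v ve.
have := fam v; rewrite ifT // inE; apply/exists_inP; by exists e.
Qed.

Lemma card_satisfying_and (R : realType) (G : hypergraph) (A : {set edge G}) :
  #|satisfying (induced_model G (and_ising R)) A| =
  (2 ^ (#|vertex G| - #|edge_cover A|))%N.
Proof.
rewrite (eq_card (satisfying_andE R G A)) card_family foldrE big_map big_enum /=.
rewrite (bigID (mem (edge_cover A))) /= big1 => [|v ->]; last by rewrite card1.
rewrite mul1n (eq_bigr (fun=> 2%N)) => [|v /negbTE ->]; last by rewrite card_ord.
by rewrite prod_nat_const -(cardC (edge_cover A)) addKn.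
Qed.

Lemma log2_expn (R : realType) (k : nat) : log2 ((2 ^ k)%N%:R : R) = k%:R.
Proof.
have ln2_neq0 : ln 2 != 0 :> R by rewrite gt_eqF// ln_gt0// ltr1n.
by rewrite /log2 natrX lnXn// -[_ *+ k]mulr_natl mulfK.
Qed.

Theorem proposition5p25 (R : realType) (G : hypergraph) (A : {set edge G}) :
  [/\ model_rank (induced_model G (and_ising R)) A = (#|edge_cover A|%:R)%:E,
      #|edge_cover A| = #|\bigcup_(e in A) edge_support e|
    & #|\bigcup_(e in A) edge_support e| = boolean_polymatroid_rank A].
Proof.
split; [|by rewrite edge_cover_bigcup | by rewrite -edge_cover_bigcup].
rewrite /model_rank card_satisfying_and expn_gt0 /= log2_expn.
by rewrite natrB ?max_card// subKr.
Qed.
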